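(* If $G$ is a $2$-tree, then $\mathrm{pind}(A_G)=1$, and hence $G$ is $(2,2)$-choosable.
   Context: Graphs are finite and simple. A graph $G$ is a $2$-tree if there is an acyclic orientation of $G$ such that: (1) there are two adjacent vertices $v_0,v_1$ with out-degrees $d^+(v_0)=0$ and $d^+(v_1)=1$; (2) every other vertex $v$ has out-degree $d^+(v)=2$, and the two out-neighbours of $v$ are adjacent. The matrix $A_G$: fix an orientation of $G$. $A_G$ is the real matrix with rows indexed by $E(G)$ and columns indexed by $V(G)\cup E(G)$, where for an edge $e$ oriented from $a$ to $b$: $A_G[e,z]=1$ if $z=b$ or $z\neq e$ is an edge incident to $b$; $A_G[e,z]=-1$ if $z=a$ or $z\ne e$ is an edge incident to $a$; and $A_G[e,z]=0$ otherwise. (Changing the orientation only multiplies rows by $-1$, so the notion below does not depend on it.) The permanent of an $m\times m$ matrix $A$ is $\mathrm{per}(A)=\sum_{\sigma\in S_m}\prod_{i=1}^m A[i,\sigma(i)]$. The permanent index $\mathrm{pind}(A)$ of a matrix $A$ is the minimum integer $k$ such that there is a square matrix $A'$ (with the same rows as $A$) with $\mathrm{per}(A')\ne0$, each column of $A'$ is a column of $A$, and each column of $A$ (identified by its column index) occurs in $A'$ at most $k$ times; if no such $k$ exists, $\mathrm{pind}(A)=\infty$. A total weighting of $G$ is a map $f:V(G)\cup E(G)\to\mathbb{R}$; the vertex sum of $v$ is $\phi_f(v)=f(v)+\sum_{e\in E(v)}f(e)$, where $E(v)$ is the set of edges incident to $v$. It is proper if $\phi_f(u)\neq\phi_f(v)$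 for every edge $uv$ of $G$. $G$ is $(k,k')$-choosable if for every assignment $L$ of a set $L(v)$ of $k$ real numbers to each vertex $v$ and a set $L(e)$ of $k'$ real numbers to each edge $e$, there is a proper total weighting $f$ with $f(z)\in L(z)$ for all $z\in V(G)\cup E(G)$. *)

(* Defs.v *)
From mathcomp Require Import all_boot all_order all_fingroup all_algebra finmap.
From mathcomp Require Import boolp reals.

Set Implicit Arguments.
Unset Strict Implicit.
Unset Printing Implicit Defensive.

Import GRing.Theory.

Local Open Scope ring_scope.

Record sgraph := SGraph {
  vertex :> finType;
  adj : rel vertex;
  adj_sym : symmetric adj;
  adj_irr : irreflexive adj }.

Definition edges (G : sgraph) : {set {set G}} :=
  [set [set p.1; p.2] | p : G * G & adj p.1 p.2].

Definition edge (G : sgraph) : Type := {e : {set G} | e \in edges G}.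

(* [ends] makes [src e] and [tgt e] distinct, since an edge of a simple graph
   has two elements. *)
Record orientation (G : sgraph) := Orientation {
  src : edge G -> G;
  tgt : edge G -> G;
  ends : forall e : edge G, val e = [set src e; tgt e] }.

Definition darc (G : sgraph) (o : orientation G) : rel G :=
  fun x y => [exists e : edge G, (src o e == x) && (tgt o e == y)].

Definition outdeg (G : sgraph) (o : orientation G) (v : G) : nat :=
  #|[set w | darc o v w]|.

Definition acyclic (G : sgraph) (o : orientation G) : Prop :=
  forall c : seq G, ucycle (darc o) c -> c = [::].

Definition two_tree (G : sgraph) : Prop :=
  exists2 o : orientation G, acyclic o &
  exists v0 v1 : G,
    [/\ adj v0 v1, outdeg o v0 = 0%N, outdeg o v1 = 1%N &
     forall v, v != v0 -> v != v1 ->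
       outdeg o v = 2%N /\
       (forall x y, darc o v x -> darc o v y -> x != y -> adj x y)].

Definition entryG (R : realType) (G : sgraph) (o : orientation G)
    (e : edge G) (z : G + edge G) : R :=
  match z with
  | inl v => if v == tgt o e then 1 else if v == src o e then -1 else 0
  | inr f => if f == e then 0
             else if tgt o e \in val f then 1
             else if src o e \in val f then -1 else 0
  end.

Definition A_ (R : realType) (G : sgraph) (o : orientation G)
    : 'M[R]_(#|{: edge G}|, #|{: G + edge G}|) :=
  \matrix_(i, j) entryG R o (enum_val i) (enum_val j).

Definition per (R : realType) (m : nat) (A : 'M[R]_m) : R :=
  \sum_(s : 'S_m) \prod_(i < m) A i (s i).

(* Column [i] of the square matrix [A'] is column [c i] of [A]. *)
Definition pind_le (R : realType) (m n : nat) (A : 'M[R]_(m, n)) : pred nat :=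
  fun k => [exists c : {ffun 'I_m -> 'I_n},
    (per (colsub c A) != 0) && [forall j, #|[set i | c i == j]| <= k]%N].

(* [None] stands for an infinite permanent index. *)
Definition pind (R : realType) (m n : nat) (A : 'M[R]_(m, n)) : option nat :=
  if pselect (exists k, pind_le A k) is left kP then Some (ex_minn kP)
  else None.

Definition vsum (R : realType) (G : sgraph) (f : G + edge G -> R) (v : G) : R :=
  f (inl v) + \sum_(e : edge G | v \in val e) f (inr e).

Definition proper (R : realType) (G : sgraph) (f : G + edge G -> R) : Prop :=
  forall u v : G, adj u v -> vsum f u != vsum f v.

Definition choosable (R : realType) (k k' : nat) (G : sgraph) : Prop :=
  forall L : G + edge G -> {fset R},
    (forall v : G, #|` L (inl v)| = k) ->
    (forall e : edge G, #|` L (inr e)| = k') ->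
    exists2 f : G + edge G -> R, proper f & forall z, f z \in L z.

(* Main.v *)
(**
In A_G the column of an edge xy is the sum of the columns of x and y.
Build the 2-tree from its root edge v0 v1, keeping a square matrix with
distinct columns and nonzero permanent.  When a set X of new vertices is added,
the columns of the vertices of X vanish on the old rows, so appending columns
that are combinations of them multiplies the permanent by that of a small
explicit matrix.  Beyond the base cases (edge and triangle) three moves suffice:
- two sources u, v with the same out-neighbours x, y: append u, v and two copies
  of v - u, rewritten as (vx) - (ux) and as (vy) - (uy);
- a vertex v with out-neighbours x, y whose only in-neighbour is a source u with
  out-neighbours v, x: append v, u, (uv) and u - v = (ux) - (vx);
- the same with a second in-neighbour w of v, a source with out-neighbours v, y:
  append moreover w and (wv).
By multilinearity one of the expanded matrices, whose columns are distinct
columns of A_G, has nonzero permanent.  A move is always available: a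
non-root vertex of largest height among those with an in-neighbour has only
sources as in-neighbours.
Choosability follows because an m-fold finite difference of the product of the
m vertex-sum differences is a multiple of such a permanent.
*)

Require Import Defs.
From mathcomp Require Import all_boot all_order all_fingroup all_algebra finmap.
From mathcomp Require Import boolp reals.
From mathcomp Require Import ring.

Set Implicit Arguments.
Unset Strict Implicit.
Unset Printing Implicit Defensive.

Import GRing.Theory Num.Theory.

(** * Permanents along lists of rows and columns *)

Section ListPermanent.
Local Open Scope ring_scope.
Variables (R : comNzRingType) (T : eqType).
Implicit Types (c d s : T -> R) (cs : seq (T -> R)) (rows : seq T).

(** Laplace expansion along the first column. Lists in place of ordinals let blocks of rows and
    columns be concatenated without casts; unequal lengths give 0. *)
Fixpoint lper cs rows : R :=
  if cs is c :: cs' then \sum_(r <- rows) c r * lper cs' (rem r rows)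
  else (rows == [::])%:R.

Lemma perm_lper cs rows rows' :
  perm_eq rows rows' -> lper cs rows = lper cs rows'.
Proof.
elim: cs rows rows' => [|c cs IH] rows rows' Hp /=.
  by congr (_%:R); rewrite -!size_eq0 (perm_size Hp).
rewrite (perm_big _ Hp) /=; apply: eq_bigr => r _; congr (_ * _).
apply: IH; case: (boolP (r \in rows)) => Hr.
  rewrite -(perm_cons r) -(permPl (perm_to_rem Hr)) (permPl Hp).
  by rewrite perm_to_rem // -(perm_mem Hp).
by rewrite !rem_id // -(perm_mem Hp).
Qed.

Lemma lper_size cs rows : lper cs rows != 0 -> size cs = size rows.
Proof.
elim: cs rows => [|c cs IH] rows /=.
  by case: rows => //= r rows; rewrite eqxx.
move=> nz; have [r Hr Hnz] : exists2 r, r \in rows & lper cs (rem r rows) != 0.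
  apply/hasP; apply: contraNT nz => /hasPn H; apply/eqP.
  rewrite big_seq big1 // => r Hr.
  by have /negPn /eqP -> := H r Hr; rewrite mulr0.
by rewrite (IH _ Hnz) size_rem // prednK //; case: rows Hr {nz Hnz}.
Qed.

Lemma lperB cs1 cs2 a b rows :
  lper (cs1 ++ (fun r => a r - b r) :: cs2) rows =
  lper (cs1 ++ a :: cs2) rows - lper (cs1 ++ b :: cs2) rows.
Proof.
elim: cs1 rows => [|c cs1 IH] rows /=; rewrite -sumrB; apply: eq_bigr => r _.
  by rewrite mulrBl.
by rewrite IH mulrBr.
Qed.

Lemma lper_scale (I : Type) (k : I -> R) (f : I -> T -> R) (w : seq I) rows :
  lper [seq (fun r => k z * f z r) | z <- w] rows =
  (\prod_(z <- w) k z) * lper (map f w) rows.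
Proof.
elim: w rows => [|z w IH] rows /=; first by rewrite big_nil mul1r.
rewrite big_cons big_distrr /=; apply: eq_bigr => r _; rewrite IH; ring.
Qed.

(** The expansion along [loc] never gains from a row of [O]; as [loc] and [L] have equal length, it
    uses up [L] and leaves exactly [O] to [cs]. *)
Lemma lper_block loc cs L O :
  size loc = size L -> (forall c r, List.In c loc -> r \in O -> c r = 0) ->
  lper (loc ++ cs) (L ++ O) = lper loc L * lper cs O.
Proof.
elim: loc L => [|c loc IH] L /=.
  by move/esym/size0nil => -> _; rewrite mul1r.
move=> Hs H0; rewrite big_cat /= [X in _ + X]big_seq [X in _ + X]big1 ?addr0.
  rewrite big_distrl /= !(big_seq_cond xpredT) /=.
  apply: eq_bigr => r; rewrite andbT => Hr.
  have -> : rem r (L ++ O) = rem r L ++ O.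
    elim: L Hr {Hs IH} => //= x L IH; rewrite inE.
    by case: (eqVneq x r) => [_|ne] //= Hr; rewrite IH.
  rewrite IH ?mulrA // ?size_rem // -?Hs //.
  by move=> c' r' H1; apply: H0; right.
by move=> r Hr; rewrite (H0 c r) ?mul0r //; left.
Qed.

(* Iterated finite difference, in the directions [cs], of the product of the
   coordinates indexed by [rows]. *)
Fixpoint fdiff cs rows s : R :=
  if cs is c :: cs' then fdiff cs' rows (fun r => s r + c r) - fdiff cs' rows s
  else \prod_(r <- rows) s r.

Lemma eq_fdiff cs rows s s' :
  {in rows, s =1 s'} -> fdiff cs rows s = fdiff cs rows s'.
Proof.
elim: cs s s' => [|c cs IH] s s' H /=.
  by rewrite !(big_seq_cond xpredT); apply: eq_bigr => r; rewrite andbT => /H.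
by rewrite (IH _ _ H) (IH _ (fun r => s' r + c r)) // => r Hr; rewrite H.
Qed.

(** The product is affine in the coordinate [r], its slope being the product over the other rows,
    and a common shift of [s] and [s'] preserves their difference. *)
Lemma fdiff_row cs rows s s' r : uniq rows -> r \in rows ->
  (forall r', r' != r -> s r' = s' r') ->
  fdiff cs rows s - fdiff cs rows s' = (s r - s' r) * fdiff cs (rem r rows) s.
Proof.
move=> Hu Hr; elim: cs s s' => [|c cs IH] s s' H /=.
  rewrite !(perm_big _ (perm_to_rem Hr)) /= !big_cons mulrBl; congr (_ - _ * _).
  rewrite !(big_seq_cond xpredT); apply: eq_bigr => r'; rewrite andbT => Hr'.
  by rewrite H //; move: Hr'; rewrite mem_rem_uniq // inE => /andP[].
have /IH E1 := H; have /IH E2 : forall r', r' != r -> s r' + c r' = s' r' + c r'.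
  by move=> r' /H ->.
rewrite mulrBr -E1.
have -> : s r - s' r = (s r + c r) - (s' r + c r) by ring.
rewrite -E2; ring.
Qed.

(** Each difference lowers the degree by one, so with at least as many directions as rows the base
    point [s] no longer matters. *)
Lemma fdiff_lper cs rows s : uniq rows -> (size rows <= size cs)%N ->
  fdiff cs rows s = lper cs rows.
Proof.
elim: cs rows s => [|c cs IH] rows s Hu /=.
  by rewrite leqn0 size_eq0 => /eqP ->; rewrite big_nil.
move=> Hs.
(* The passage from [s] to [s + c] is made one row at a time; [rs] holds the rows already
   shifted. *)
have key rs : uniq rs -> {subset rs <= rows} ->
    fdiff cs rows (fun r => if r \in rs then s r + c r else s r)
      - fdiff cs rows s = \sum_(r <- rs) c r * lper cs (rem r rows).
  elim: rs => [|r rs IHrs] /=; first by rewrite big_nil subrr.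
  move=> /andP[Hr Hurs] Hsub; rewrite big_cons -IHrs //; last first.
    by move=> x Hx; apply: Hsub; rewrite inE Hx orbT.
  have Hrr : r \in rows by apply: Hsub; rewrite inE eqxx.
  rewrite addrA; congr (_ - _); apply/eqP; rewrite -subr_eq; apply/eqP.
  rewrite (fdiff_row cs Hu Hrr) => [|r' ne]; last by rewrite inE (negPf ne).
  rewrite inE eqxx (negPf Hr) /= IH ?rem_uniq //; first by ring.
  by rewrite size_rem //; case: (rows) Hs.
rewrite -(key rows) //; congr (_ - _); apply: eq_fdiff => r Hr.
by rewrite Hr.
Qed.

End ListPermanent.

(** * Permanents with integer entries *)

Section LocalComputation.
Local Open Scope ring_scope.

Lemma lper_map (R : comNzRingType) (T T' : eqType) (h : T -> T')
    (cs : seq (T' -> R)) (rows : seq T) : uniq rows ->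
  {in rows &, injective h} ->
  lper cs (map h rows) = lper [seq c \o h | c <- cs] rows.
Proof.
elim: cs rows => [|c cs IH] rows Hu Hi /=.
  by rewrite -!size_eq0 size_map.
rewrite big_map !(big_seq_cond xpredT) /=; apply: eq_bigr => r.
rewrite andbT => Hr; rewrite -IH ?rem_uniq //; last first.
  by move=> x y /mem_rem Hx /mem_rem Hy; apply: Hi.
congr (_ * lper _ _).
elim: rows Hi Hr Hu {IH} => //= x rows IH Hi Hr /andP[Hx Hu].
rewrite (inj_in_eq Hi) ?inE ?eqxx //; case: (eqVneq x r) => //= ne.
rewrite IH //.
  by move=> a b Ha Hb; apply: Hi; rewrite inE ?Ha ?Hb orbT.
by move: Hr; rewrite inE eq_sym (negPf ne).
Qed.

(** [M] lists columns. Big operators are locked, so [foldr] is used to make concrete instances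
    compute. *)
Fixpoint zper (M : seq (seq int)) (rows : seq nat) : int :=
  if M is m :: M' then
    foldr (fun r a => nth 0 m r * zper M' (rem r rows) + a) 0 rows
  else (rows == [::])%:R.

(* Reduces a permanent with integer entries to a closed computation. *)
Lemma lper_zper (R : comNzRingType) (T : eqType) (cs : seq (T -> R))
    (L : seq T) (M : seq (seq int)) : uniq L ->
  [seq map c L | c <- cs] = [seq map intr m | m <- M] ->
  lper cs L = (zper M (iota 0 (size L)))%:~R.
Proof.
case: L => [|x0 L0] Hu.
  by case: cs M => [|c cs] [|m M] //= _; rewrite big_nil.
move: (x0 :: L0) Hu => L Hu H.
rewrite -{1}(mkseq_nth x0 L) /mkseq lper_map ?iota_uniq //; last first.
  move=> i j; rewrite !mem_iota !add0n /= => Hi Hj /eqP.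
  by rewrite nth_uniq // => /eqP.
(* The expansion deletes rows, so the induction must range over all lists of indices contained in
   the full one. *)
have : {subset iota 0 (size L) <= iota 0 (size L)} by [].
elim: cs M {1 3 4}(iota 0 (size L)) H => [|c cs IH] [|m M] //= rows.
  by move=> _ _; case: rows.
move=> [Hm HM] Hs.
have -> : foldr (fun r a => nth 0 m r * zper M (rem r rows) + a) 0 rows =
    \sum_(r <- rows) nth 0 m r * zper M (rem r rows) by rewrite unlock.
rewrite rmorph_sum /= !(big_seq_cond xpredT); apply: eq_bigr => r.
rewrite andbT => Hr; rewrite intrM (IH M) //; last by move=> x /mem_rem /Hs.
have := Hs _ Hr; rewrite mem_iota add0n /= => Hrs; congr (_ * _).
have Hsm : size m = size L by rewrite -(size_map c L) Hm size_map.
by rewrite -[LHS](nth_map x0 0) // Hm (nth_map 0) // Hsm.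
Qed.

End LocalComputation.

(** * Permanents of square matrices as list permanents *)

Section Permanent.
Local Open Scope ring_scope.

(** Permutations are grouped by the image [i] of 0; [lift_perm ord0 i] identifies a group with
    ['S_n], which matches the deletion of row [i]. *)
Lemma perm_sum_lper (R : comNzRingType) (T : eqType) n (c : 'I_n -> T -> R)
    (e : 'I_n -> T) : injective e ->
  \sum_(s : 'S_n) \prod_(j < n) c j (e (s j)) =
  lper [seq c j | j <- enum 'I_n] [seq e i | i <- enum 'I_n].
Proof.
elim: n c e => [|n IH] c e He.
  rewrite !enum_ord0 /= (big_pred1 1%g) ?big_ord0 // => s.
  by apply/esym/eqP/permP => -[].
rewrite {1}enum_ordSl /= big_map big_enum /=.
rewrite (partition_big (fun s : 'S_n.+1 => s ord0) predT) //=.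
apply: eq_bigr => i _.
have {IH} := IH (c \o lift ord0) (e \o lift i) (inj_comp He (@lift_inj _ i)).
move=> IH.
have Hrows : perm_eq (rem (e i) [seq e k | k <- enum 'I_n.+1])
                     [seq (e \o lift i) j | j <- enum 'I_n].
  apply/uniq_perm.
  - by rewrite rem_uniq // map_inj_uniq // enum_uniq.
  - by rewrite (map_inj_uniq (inj_comp He (@lift_inj _ i))) enum_uniq.
  move=> x; rewrite mem_rem_uniq ?(map_inj_uniq He) ?enum_uniq // inE.
  apply/andP/mapP => [[ne /mapP[k _ Ek]]|[j _ ->]] /=.
    case: (unliftP i k) => [j|] Ej; last by rewrite Ek Ej eqxx in ne.
    by exists j; rewrite ?mem_enum //= -Ej.
  by rewrite (inj_eq He) eq_sym neq_lift map_f // mem_enum.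
rewrite (perm_lper _ Hrows) -map_comp -IH big_distrr /= (reindex (lift_perm ord0 i)) /=; last first.
  (* The inverse correspondence: [s] away from 0, renumbered to skip the value [s ord0]. *)
  pose g (s : 'S_n.+1) k := odflt k (unlift (s ord0) (s (lift ord0 k))).
  have gK (s : 'S_n.+1) k : lift (s ord0) (g s k) = s (lift ord0 k).
    rewrite /g; have := neq_lift ord0 k.
    by rewrite -(inj_eq (@perm_inj _ s)) => /unlift_some[? ? ->].
  have g_inj (s : 'S_n.+1) : injective (g s).
    by move=> k k' /(congr1 (lift (s ord0))); rewrite !gK => /perm_inj/lift_inj.
  exists (fun s => perm (@g_inj s)) => [s _ | s].
    by apply/permP=> k; rewrite permE /g lift_perm_lift lift_perm_id liftK.
  move=> /eqP si; apply/permP=> k.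
  case: (unliftP ord0 k) => [k'|] ->; rewrite ?lift_perm_id ?si //.
  by rewrite lift_perm_lift -si permE gK.
apply: eq_big => [s|s _]; first by rewrite lift_perm_id eqxx.
rewrite big_ord_recl lift_perm_id; congr (_ * _); apply: eq_bigr => j _ /=.
by rewrite lift_perm_lift.
Qed.

Lemma per_lper (R : realType) (T : eqType) n (c : 'I_n -> T -> R)
    (e : 'I_n -> T) : injective e ->
  per (\matrix_(i, j) c j (e i)) =
  lper [seq c j | j <- enum 'I_n] [seq e i | i <- enum 'I_n].
Proof.
(* [per] assigns columns to rows and [lper] rows to columns, hence the inversion. *)
move=> He; rewrite -perm_sum_lper // /per (reindex_inj invg_inj) /=.
apply: eq_bigr => s _; rewrite (reindex_inj (@perm_inj _ s)) /=.
by apply: eq_bigr => i _; rewrite !mxE permK.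
Qed.

End Permanent.

(** * Columns of A_G *)

Section Columns.
Local Open Scope ring_scope.
Variables (R : realType) (G : sgraph) (o : orientation G).
Notation src := (src o).
Notation tgt := (tgt o).

(** Coefficient of the weight of [z] in the vertex sum at [v]. *)
Definition incidence (z : G + edge G) (v : G) : R :=
  match z with inl u => (v == u)%:R | inr f => (v \in val f)%:R end.

Definition zcol (z : G + edge G) (e : edge G) : R :=
  incidence z (tgt e) - incidence z (src e).

Lemma zcolE z e : zcol z e = incidence z (tgt e) - incidence z (src e).
Proof. by []. Qed.

Lemma src_edge (e : edge G) : src e \in val e.
Proof. by rewrite (ends o e) !inE eqxx. Qed.

Lemma tgt_edge (e : edge G) : tgt e \in val e.
Proof. by rewrite (ends o e) !inE eqxx orbT. Qed.

Lemma adj_edge (u v : G) : adj u v -> exists e : edge G, val e = [set u; v].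
Proof.
move=> Huv; have He : [set u; v] \in edges G by apply/imsetP; exists (u, v); rewrite ?inE.
by exists (exist (fun e => e \in edges G) _ He).
Qed.

Lemma edge_adj (e : edge G) : adj (src e) (tgt e).
Proof.
have /imsetP[[x y] /= Hxy E] := valP e.
have Hne : x != y by apply: contraTneq Hxy => ->; rewrite ?inE /= adj_irr.
have Hc : #|[set x; y]| = 2%N by rewrite cards2 Hne.
rewrite (ends o) in E; rewrite inE /= in Hxy.
have : src e != tgt e.
  by apply/eqP => Est; move: Hc; rewrite -E Est setUid cards1.
have := src_edge e; have := tgt_edge e; rewrite (ends o) E !inE.
move=> /pred2P[] -> /pred2P[] ->; rewrite ?eqxx // => _.
by rewrite adj_sym.
Qed.

Lemma src_tgt (e : edge G) : src e != tgt e.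
Proof. by apply: contraTneq (edge_adj e) => ->; rewrite adj_irr. Qed.

Lemma edge_eq (e f : edge G) : src e \in val f -> tgt e \in val f -> e = f.
Proof.
move=> Hs Ht; apply/val_inj/eqP; rewrite eqEcard; apply/andP; split.
  by rewrite {1}(ends o e); apply/subsetP => x; rewrite !inE => /pred2P[] ->.
by rewrite !(ends o) !cards2 !src_tgt.
Qed.

Lemma edge_eq_ends (e f : edge G) : src e = src f -> tgt e = tgt f -> e = f.
Proof. by move=> Es Et; apply: edge_eq; rewrite ?Es ?Et ?src_edge ?tgt_edge. Qed.

Lemma adj_or (u v : G) : adj u v ->
  exists e : edge G, src e = u /\ tgt e = v \/ src e = v /\ tgt e = u.
Proof.
move=> /adj_edge[e He]; exists e; have := src_tgt e.
have := src_edge e; have := tgt_edge e; rewrite He !inE.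
by move=> /pred2P[] -> /pred2P[] ->; rewrite ?eqxx //; [right|left].
Qed.

(** The delicate case, both ends of [e] in [f], forces [e = f] in a simple graph, and there the two
    incidences cancel. *)
Lemma entryGE (e : edge G) (z : G + edge G) : entryG R o e z = zcol z e.
Proof.
case: z => [v|f]; rewrite /zcol /=.
  rewrite !(eq_sym v); case: eqP => [<-|_]; rewrite ?sub0r.
    by rewrite (negPf (src_tgt e)) subr0.
  by case: eqP => _; rewrite ?oppr0.
case: eqP => [->|ne]; first by rewrite src_edge tgt_edge subrr.
case: (boolP (tgt e \in _)) => Ht; last by case: ifP; rewrite sub0r ?oppr0.
case: (boolP (src e \in _)) => Hs; last by rewrite subr0.
by case: ne; rewrite (edge_eq Hs Ht).
Qed.

Lemma zcol_edge (f e : edge G) :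
  zcol (inr f) e = zcol (inl (src f)) e + zcol (inl (tgt f)) e.
Proof.
have inc v : (v \in val f)%:R = (v == src f)%:R + (v == tgt f)%:R :> R.
  rewrite (ends o f) !inE; case: eqP => [->|_]; rewrite ?add0r //.
  by rewrite (negPf (src_tgt f)) addr0.
by rewrite /zcol /= !inc; ring.
Qed.

Lemma zcol_src v e : src e = v -> zcol (inl v) e = -1.
Proof.
by move=> <-; rewrite /zcol /= eqxx eq_sym (negPf (src_tgt e)) sub0r.
Qed.

Lemma zcol_tgt v e : tgt e = v -> zcol (inl v) e = 1.
Proof. by move=> <-; rewrite /zcol /= eqxx (negPf (src_tgt e)) subr0. Qed.

Lemma zcol0 v e : src e != v -> tgt e != v -> zcol (inl v) e = 0.
Proof. by rewrite /zcol /= => /negPf -> /negPf ->; rewrite subrr. Qed.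

Lemma darcP x y : reflect (exists2 e, src e = x & tgt e = y) (darc o x y).
Proof.
apply: (iffP existsP) => [[e /andP[/eqP Hx /eqP Hy]]|[e Hx Hy]]; exists e => //.
by rewrite Hx Hy !eqxx.
Qed.

Lemma darc_edge e : darc o (src e) (tgt e).
Proof. by apply/darcP; exists e. Qed.

Lemma outdeg2_other e : outdeg o (src e) = 2%N ->
  exists g, [/\ src g = src e, tgt g != tgt e &
    forall e', src e' = src e -> e' = e \/ e' = g].
Proof.
rewrite /outdeg => /eqP/cards2P[x [y [ne E]]].
have H w : darc o (src e) w = (w \in [set x; y]) by rewrite -E inE.
have key z t : z != t -> tgt e = z -> darc o (src e) t ->
    (forall w, darc o (src e) w -> w = z \/ w = t) ->
    exists g, [/\ src g = src e, tgt g != tgt e &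
    forall e', src e' = src e -> e' = e \/ e' = g].
  move=> nzt ez /darcP[g gs gt] Hall; exists g; split=> //.
    by rewrite gt ez eq_sym.
  move=> e' es; have : darc o (src e) (tgt e') by rewrite -es darc_edge.
  case/Hall => et; [left|right]; apply: edge_eq_ends; rewrite ?es ?et //.
have := darc_edge e; rewrite H !inE => /orP[/eqP|/eqP] Et.
  by apply: (key x y) => [|||w]; rewrite ?H ?inE ?eqxx ?orbT //; move/pred2P.
apply: (key y x) => [|||w]; rewrite ?H ?inE ?eqxx // 1?eq_sym //.
by move=> /pred2P[]; [right|left].
Qed.

Lemma outdeg_gt0 v : (0 < outdeg o v)%N -> exists e, src e = v.
Proof. by move=> /card_gt0P[w]; rewrite inE => /darcP[e He _]; exists e. Qed.

(** A rank that strictly decreases along arcs. *)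
Definition height (v : G) : nat := #|connect (darc o) v|.

Lemma height_lt e : acyclic o -> (height (tgt e) < height (src e))%N.
Proof.
move=> Hac; apply: proper_card; apply/properP; split.
  apply/subsetP => y; apply: connect_trans; apply: connect1; exact: darc_edge.
exists (src e); first by rewrite inE connect0.
apply/negP; rewrite inE => /connectP[p Hp Ep].
(* A path from head back to tail would close a cycle; it is made simple first because [ucycle]
   requires distinct vertices. *)
case/shortenP: Hp Ep => p' Hp' Hu _ Ep'.
have := Hac (tgt e :: p'); rewrite /ucycle Hu andbT /= rcons_path Hp' -Ep'.
by move=> /(_ (darc_edge e)).
Qed.

End Columns.

(** * The three moves and the base cases *)

Section Extension.
Local Open Scope ring_scope.
Variables (R : realType) (G : sgraph) (o : orientation G).
Notation src := (src o).
Notation tgt := (tgt o).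
Notation zcol := (zcol R o).
Implicit Types (U X : {set G}) (e : edge G).

Definition out_closed U := forall e, src e \in U -> tgt e \in U.

Definition rows U : seq (edge G) := [seq e <- enum {: edge G} | src e \in U].

Lemma rows_uniq U : uniq (rows U).
Proof. exact: filter_uniq (enum_uniq _). Qed.

Lemma mem_rows U e : (e \in rows U) = (src e \in U).
Proof. by rewrite mem_filter (mem_enum (_ : pred {: edge G})) andbT. Qed.

(* An edge belongs to its source, so the edges spanned by an out-closed set [U]
   are those owned by [U]. *)
Definition owner (z : G + edge G) : G :=
  match z with inl v => v | inr e => src e end.

(** The ownership clause keeps old labels apart from those added later. That [w] has as many labels
    as there are rows follows from [lper_size]. *)
Definition good U := exists w : seq (G + edge G),
  [/\ uniq w, {in w, forall z, owner z \in U} & lper (map zcol w) (rows U) != 0].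

Lemma good0 : good set0.
Proof.
exists [::]; split=> //; rewrite /rows (eq_filter (a2 := pred0)).
  by rewrite filter_pred0 /= oner_eq0.
by move=> e; rewrite inE.
Qed.

Lemma uniq_labels (us : seq G) (es : seq (edge G)) :
  uniq us -> uniq es -> uniq (map inl us ++ map inr es).
Proof.
move=> Hu He; rewrite cat_uniq !map_inj_uniq ?Hu ?He //=; last 2 first.
- by move=> x y [].
- by move=> x y [].
by rewrite andbT; apply/hasPn => z /mapP[e _ ->]; apply/mapP => -[].
Qed.

(* The columns in [loc] live on the new rows only, so the enlarged matrix is
   block triangular. *)
Lemma good_extend U X (L : seq (edge G)) (loc : seq (edge G -> R)) M :
  X \subset U -> out_closed (U :\: X) -> good (U :\: X) ->
  uniq L -> (forall e, (e \in L) = (src e \in X)) ->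
  [seq map c L | c <- loc] = [seq map intr m | m <- M] ->
  zper M (iota 0 (size L)) != 0 -> size loc = size L ->
  (forall c e, List.In c loc ->
     (forall v, v \in X -> zcol (inl v) e = 0) -> c e = 0) ->
  (forall cs rows, lper (loc ++ cs) rows != 0 ->
     exists us es, [/\ uniq us, uniq es, {subset us <= X}, {subset es <= L} &
       lper (map zcol (map inl us ++ map inr es) ++ cs) rows != 0]) ->
  good U.
Proof.
move=> XU HU [w [w_uniq w_own w_nz]] L_uniq HL HM M_nz Hsz Hloc Hopt.
have Hrows : perm_eq (L ++ rows (U :\: X)) (rows U).
  apply: uniq_perm.
  - rewrite cat_uniq L_uniq rows_uniq andbT /=.
    by apply/hasPn => e; rewrite mem_rows inE HL => /andP[].
  - exact: rows_uniq.
  move=> e; rewrite mem_cat HL !mem_rows inE.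
  by case: (boolP (src e \in X)) => // /(subsetP XU) ->.
have : lper (loc ++ map zcol w) (L ++ rows (U :\: X)) != 0.
  rewrite lper_block // ?mulf_neq0 //; first by rewrite (lper_zper L_uniq HM) intr_eq0.
  (* An old row has its source outside [X], and its target too by out-closedness, so the vertex
     columns of [X] vanish there. *)
  move=> c e Hc; rewrite mem_rows => He; apply: Hloc Hc _ => v Hv.
  apply: zcol0; first by apply: contraTneq He => ->; rewrite inE Hv.
  by apply: contraTneq (HU _ He) => ->; rewrite inE Hv.
case/Hopt => us [es [us_uniq es_uniq usX esL nz]].
have own z : z \in map inl us ++ map inr es -> owner z \in X.
  by rewrite mem_cat => /orP[] /mapP[x Hx ->] /=; rewrite -?HL; auto.
exists ((map inl us ++ map inr es) ++ w); split.
- rewrite cat_uniq uniq_labels // w_uniq andbT /=; apply/hasPn => z /w_own.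
  by rewrite inE => /andP[Hz _]; apply: contra Hz => /own.
- move=> z; rewrite mem_cat => /orP[/own/(subsetP XU)|/w_own] //.
  by rewrite inE => /andP[].
by rewrite map_cat -(perm_lper _ Hrows).
Qed.

Lemma lperB_neq0 cs1 cs2 (a b : edge G -> R) rows :
  lper (cs1 ++ (fun r => a r - b r) :: cs2) rows != 0 ->
  lper (cs1 ++ a :: cs2) rows != 0 \/ lper (cs1 ++ b :: cs2) rows != 0.
Proof.
rewrite lperB; case: (eqVneq (lper (cs1 ++ a :: cs2) rows) 0) => [->|]; last by left.
by rewrite sub0r oppr_eq0; right.
Qed.

Lemma zcol_edge_fun f :
  zcol (inr f) = (fun e => zcol (inl (src f)) e + zcol (inl (tgt f)) e).
Proof. by apply: funext => e; rewrite zcol_edge. Qed.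

(** The column of the common target cancels. This trades a difference of vertex columns for one of
    edge columns. *)
Lemma zcolB_same_tgt e f : tgt e = tgt f ->
  (fun r => zcol (inl (src e)) r - zcol (inl (src f)) r) =
  (fun r => zcol (inr e) r - zcol (inr f) r).
Proof.
by move=> E; apply: funext => r; rewrite !zcol_edge E; ring.
Qed.

(** The common out-neighbours give two expressions of [d] by edge columns. Using a different one for
    each copy yields four candidates, all with distinct columns. *)
Lemma good_twins U u v f1 g1 f2 g2 :
  u \in U -> v \in U -> u != v ->
  out_closed (U :\: [set u; v]) -> good (U :\: [set u; v]) ->
  src f1 = u -> src g1 = u -> src f2 = v -> src g2 = v ->
  (forall e, src e = u -> e = f1 \/ e = g1) ->
  (forall e, src e = v -> e = f2 \/ e = g2) ->
  tgt f1 = tgt f2 -> tgt g1 = tgt g2 -> tgt f1 != tgt g1 ->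
  tgt f1 \notin [:: u; v] -> tgt g1 \notin [:: u; v] ->
  good U.
Proof.
move=> Hu Hv uv Hcl Hg sf1 sg1 sf2 sg2 all1 all2 tf tg tfg nf ng.
pose d := fun r => zcol (inl v) r - zcol (inl u) r.
have d1 : d = (fun r => zcol (inr f2) r - zcol (inr f1) r).
  by rewrite -zcolB_same_tgt ?sf1 ?sf2.
have d2 : d = (fun r => zcol (inr g2) r - zcol (inr g1) r).
  by rewrite -zcolB_same_tgt ?sg1 ?sg2.
have ne1 : f1 != g1 by apply: contraNneq tfg => ->.
have ne2 : f2 != g2 by apply: contraNneq tfg => E; rewrite tf tg E.
have ne e e' : src e = u -> src e' = v -> e != e'.
  by move=> se se'; apply: contraNneq uv => E; rewrite -se -se' E.
move: nf ng; rewrite !inE !negb_or => /andP[nfu nfv] /andP[ngu ngv].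
(* Each inner list is a column along [f1; g1; f2; g2]; the permanent is -8. *)
apply: (@good_extend U [set u; v] [:: f1; g1; f2; g2]
  [:: zcol (inl u); zcol (inl v); d; d]
  [:: [:: -1; -1; 0; 0]; [:: 0; 0; -1; -1];
      [:: 1; 1; -1; -1]; [:: 1; 1; -1; -1]]%Z) => //.
- by apply/subsetP => x; rewrite !inE => /pred2P[] ->.
- by rewrite /= !inE !negb_or ne1 ne2 !ne.
- move=> e; rewrite !inE; apply/idP/idP.
    by move=> /or4P[] /eqP ->; rewrite ?sf1 ?sg1 ?sf2 ?sg2 eqxx ?orbT.
  by move=> /pred2P[/all1|/all2] [] ->; rewrite eqxx ?orbT.
- rewrite /= /d.
  have vu : v != u by rewrite eq_sym.
  rewrite !(zcol_src R sf1) !(zcol_src R sg1) !(zcol_src R sf2) !(zcol_src R sg2).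
  rewrite !(@zcol0 R G o) -?tf -?tg ?sf1 ?sg1 ?sf2 ?sg2 //.
  by rewrite !subr0 !sub0r opprK.
- move=> c e Hc H0; have Zu : zcol (inl u) e = 0 by rewrite H0 // !inE eqxx.
  have Zv : zcol (inl v) e = 0 by rewrite H0 // !inE eqxx orbT.
  by case: Hc => [<-|[<-|[<-|[<-|[]]]]] //; rewrite /d Zu Zv subrr.
move=> cs rs.
(* The first copy of [d] goes through the targets of [f1, f2], the second one later through those of
   [g1, g2]. *)
rewrite -[_ ++ _]/([:: zcol (inl u); zcol (inl v)] ++ d :: (d :: cs)) {1}d1.
have Hf x y : (x == f1) || (x == f2) -> (y == g1) || (y == g2) ->
    uniq [:: x; y] /\ {subset [:: x; y] <= [:: f1; g1; f2; g2]}.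
  move=> Hx Hy; split.
    rewrite /= inE andbT; apply: contraNneq tfg => E.
    have <- : tgt x = tgt f1 by case/pred2P: Hx => ->.
    by rewrite E; case/pred2P: Hy => ->; rewrite ?tg.
  by move=> z; rewrite !inE => /pred2P[] ->;
    [case/pred2P: Hx|case/pred2P: Hy] => ->; rewrite eqxx ?orbT.
have Hend x y : (x == f1) || (x == f2) -> (y == g1) || (y == g2) ->
  lper ([:: zcol (inl u); zcol (inl v); zcol (inr x); zcol (inr y)] ++ cs) rs != 0 ->
  exists us es, [/\ uniq us, uniq es, {subset us <= [set u; v]},
       {subset es <= [:: f1; g1; f2; g2]} &
       lper (map zcol (map inl us ++ map inr es) ++ cs) rs != 0].
  move=> Hx Hy nz; have [H1 H2] := Hf _ _ Hx Hy.
  exists [:: u; v], [:: x; y]; split=> //; first by rewrite /= inE uv.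
  by move=> z; rewrite !inE.
by case/lperB_neq0;
  rewrite -[_ ++ _]/([:: zcol (inl u); zcol (inl v); zcol _] ++ d :: cs) d2;
  case/lperB_neq0; apply: Hend; rewrite eqxx ?orbT.
Qed.

(** Since [b] and [f] share their target, [d] is a difference of their columns, and both edges
    differ from [a], whose column is already present. *)
Lemma good_child U v u f g a b :
  v \in U -> u \in U -> u != v ->
  out_closed (U :\: [set v; u]) -> good (U :\: [set v; u]) ->
  src f = v -> src g = v -> src a = u -> src b = u ->
  (forall e, src e = v -> e = f \/ e = g) ->
  (forall e, src e = u -> e = a \/ e = b) ->
  tgt a = v -> tgt b = tgt f -> tgt f != tgt g ->
  tgt f \notin [:: v; u] -> tgt g \notin [:: v; u] ->
  good U.
Proof.
move=> Hv Hu uv Hcl Hg sf sg sa sb allv allu ta tb tfg.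
rewrite !inE !negb_or => /andP[nfv nfu] /andP[ngv ngu].
pose d := fun r => zcol (inl u) r - zcol (inl v) r.
have dE : d = (fun r => zcol (inr b) r - zcol (inr f) r).
  by rewrite -zcolB_same_tgt ?sb ?sf.
have fg : f != g by apply: contraNneq tfg => ->.
have ab : a != b by apply: contraNneq nfv => E; rewrite -tb -E ta.
have ne e e' : src e = v -> src e' = u -> e != e'.
  by move=> se se'; apply: contraNneq uv => E; rewrite -se -se' E.
have vu : v != u by rewrite eq_sym.
(* The permanent is 6. *)
apply: (@good_extend U [set v; u] [:: f; g; a; b]
  [:: zcol (inl v); zcol (inl u); d; zcol (inr a)]
  [:: [:: -1; -1; 1; 0]; [:: 0; 0; -1; -1];
      [:: 1; 1; -2; -1]; [:: -1; -1; 0; -1]]%Z) => //.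
- by apply/subsetP => x; rewrite !inE => /pred2P[] ->.
- by rewrite /= !inE !negb_or fg ab !ne.
- move=> e; rewrite !inE; apply/idP/idP.
    by move=> /or4P[] /eqP ->; rewrite ?sf ?sg ?sa ?sb eqxx ?orbT.
  by move=> /pred2P[/allv|/allu] [] ->; rewrite eqxx ?orbT.
- rewrite /= /d zcol_edge_fun sa ta.
  rewrite !(zcol_src R sf) !(zcol_src R sg) !(zcol_src R sa) !(zcol_src R sb).
  rewrite !(zcol_tgt R ta) !(@zcol0 R G o) ?tb ?sf ?sg ?sa ?sb //.
  by congr [:: [:: _; _; _; _]; [:: _; _; _; _]; [:: _; _; _; _];
              [:: _; _; _; _]]; ring.
- move=> c e Hc H0; have Zv : zcol (inl v) e = 0 by rewrite H0 // !inE eqxx.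
  have Zu : zcol (inl u) e = 0 by rewrite H0 // !inE eqxx orbT.
  case: Hc => [<-|[<-|[<-|[<-|[]]]]] //; first by rewrite /d Zu Zv subrr.
  by rewrite zcol_edge sa ta Zu Zv addr0.
move=> cs rs.
rewrite -[_ ++ _]/([:: zcol (inl v); zcol (inl u)] ++ d :: (zcol (inr a) :: cs)).
have Hend x : (x == b) || (x == f) ->
  lper ([:: zcol (inl v); zcol (inl u); zcol (inr x); zcol (inr a)] ++ cs) rs
    != 0 ->
  exists us es, [/\ uniq us, uniq es, {subset us <= [set v; u]},
       {subset es <= [:: f; g; a; b]} &
       lper (map zcol (map inl us ++ map inr es) ++ cs) rs != 0].
  move=> Hx nz; exists [:: v; u], [:: x; a]; split=> //.
  - by rewrite /= inE vu.
  - rewrite /= inE andbT; case/pred2P: Hx => ->; first by rewrite eq_sym.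
    exact: ne.
  - by move=> z; rewrite !inE.
  move=> z; rewrite !inE => /pred2P[] ->; last by rewrite eqxx ?orbT.
  by case/pred2P: Hx => ->; rewrite eqxx ?orbT.
by rewrite dE => /lperB_neq0[]; apply: Hend; rewrite eqxx ?orbT.
Qed.

(** As for one child; the second child [w] brings its own column and that of its edge [c] to [v],
    and no further expansion. *)
Lemma good_children U v u w f g a b c d :
  v \in U -> u \in U -> w \in U -> u != v -> w != v -> u != w ->
  out_closed (U :\: [set v; u; w]) -> good (U :\: [set v; u; w]) ->
  src f = v -> src g = v -> src a = u -> src b = u -> src c = w -> src d = w ->
  (forall e, src e = v -> e = f \/ e = g) ->
  (forall e, src e = u -> e = a \/ e = b) ->
  (forall e, src e = w -> e = c \/ e = d) ->
  tgt a = v -> tgt b = tgt f -> tgt c = v -> tgt d = tgt g -> tgt f != tgt g ->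
  tgt f \notin [:: v; u; w] -> tgt g \notin [:: v; u; w] ->
  good U.
Proof.
move=> Hv Hu Hw uv wv uw Hcl Hg sf sg sa sb sc sd allv allu allw ta tb tc td tfg.
rewrite !inE !negb_or => /and3P[nfv nfu nfw] /and3P[ngv ngu ngw].
pose h := fun r => zcol (inl u) r - zcol (inl v) r.
have hE : h = (fun r => zcol (inr b) r - zcol (inr f) r).
  by rewrite -zcolB_same_tgt ?sb ?sf.
have fg : f != g by apply: contraNneq tfg => ->.
have ab : a != b by apply: contraNneq nfv => E; rewrite -tb -E ta.
have cd : c != d by apply: contraNneq ngv => E; rewrite -td -E tc.
have ne e e' : src e != src e' -> e != e' by apply: contraNneq => ->.
have vu : v != u by rewrite eq_sym.
have vw : v != w by rewrite eq_sym.
have wu : w != u by rewrite eq_sym.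
(* The permanent is -12. *)
apply: (@good_extend U [set v; u; w] [:: f; g; a; b; c; d]
  [:: zcol (inl v); zcol (inl u); zcol (inl w); h; zcol (inr a); zcol (inr c)]
  [:: [:: -1; -1; 1; 0; 1; 0]; [:: 0; 0; -1; -1; 0; 0];
      [:: 0; 0; 0; 0; -1; -1]; [:: 1; 1; -2; -1; -1; 0];
      [:: -1; -1; 0; -1; 1; 0]; [:: -1; -1; 1; 0; 0; -1]]%Z) => //.
- by apply/subsetP => x; rewrite !inE => /orP[/pred2P[]|/eqP] ->.
- rewrite /= !inE !negb_or fg ab cd.
  by rewrite !ne ?sf ?sg ?sa ?sb ?sc ?sd.
- move=> e; rewrite !inE; apply/idP/idP.
    by do ![case/orP] => /eqP ->; rewrite ?sf ?sg ?sa ?sb ?sc ?sd eqxx ?orbT.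
  by move=> /orP[/pred2P[/allv|/allu]|/eqP/allw] [] ->; rewrite eqxx ?orbT.
- rewrite /= /h !zcol_edge_fun sa ta sc tc.
  rewrite !(zcol_src R sf) !(zcol_src R sg) !(zcol_src R sa) !(zcol_src R sb).
  rewrite !(zcol_src R sc) !(zcol_src R sd) !(zcol_tgt R ta) !(zcol_tgt R tc).
  rewrite !(@zcol0 R G o) ?tb ?td ?ta ?tc ?sf ?sg ?sa ?sb ?sc ?sd //.
  by congr [:: [:: _; _; _; _; _; _]; [:: _; _; _; _; _; _];
    [:: _; _; _; _; _; _]; [:: _; _; _; _; _; _];
    [:: _; _; _; _; _; _]; [:: _; _; _; _; _; _]]; ring.
- move=> k e Hk H0; have Zv : zcol (inl v) e = 0 by rewrite H0 // !inE eqxx.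
  have Zu : zcol (inl u) e = 0 by rewrite H0 // !inE eqxx orbT.
  have Zw : zcol (inl w) e = 0 by rewrite H0 // !inE eqxx orbT.
  case: Hk => [<-|[<-|[<-|[<-|[<-|[<-|[]]]]]]] //.
  - by rewrite /h Zu Zv subrr.
  - by rewrite zcol_edge sa ta Zu Zv addr0.
  - by rewrite zcol_edge sc tc Zw Zv addr0.
move=> cs rs.
rewrite -[_ ++ _]/([:: zcol (inl v); zcol (inl u); zcol (inl w)] ++
  h :: (zcol (inr a) :: zcol (inr c) :: cs)).
have Hend x : (x == b) || (x == f) ->
  lper ([:: zcol (inl v); zcol (inl u); zcol (inl w);
            zcol (inr x); zcol (inr a); zcol (inr c)] ++ cs) rs != 0 ->
  exists us es, [/\ uniq us, uniq es, {subset us <= [set v; u; w]},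
       {subset es <= [:: f; g; a; b; c; d]} &
       lper (map zcol (map inl us ++ map inr es) ++ cs) rs != 0].
  move=> Hx nz; exists [:: v; u; w], [:: x; a; c]; split=> //.
  - by rewrite /= !inE negb_or vu vw uw.
  - rewrite /= !inE negb_or andbT (ne a c) ?sa ?sc // andbT.
    case/pred2P: Hx => ->; first by rewrite eq_sym ab ne // sb sc.
    by rewrite !ne ?sf ?sa ?sc.
  - by move=> z; rewrite !inE orbA.
  move=> z; rewrite !inE => /or3P[] /eqP ->; try by rewrite eqxx ?orbT.
  by case/pred2P: Hx => ->; rewrite eqxx ?orbT.
by rewrite hE => /lperB_neq0[]; apply: Hend; rewrite eqxx ?orbT.
Qed.

Lemma good_edge v0 v1 e :
  src e = v1 -> tgt e = v0 ->
  (forall e', src e' = v0 \/ src e' = v1 -> e' = e) ->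
  good [set v0; v1].
Proof.
move=> se te alle.
apply: (@good_extend _ [set v0; v1] [:: e] [:: zcol (inl v1)] [:: [:: -1]]%Z) => //.
- by move=> e'; rewrite setDv inE.
- by rewrite setDv; exact: good0.
- move=> e'; rewrite !inE; apply/eqP/pred2P => [->|]; last exact: alle.
  by right.
- by rewrite /= (zcol_src R se).
- by move=> c e' [<-|[]] H0; rewrite H0 // !inE eqxx orbT.
move=> cs rs nz; exists [:: v1], [::]; split=> //.
by move=> x; rewrite !inE => ->; rewrite orbT.
Qed.

(** A lone source over the root edge has no twin to be removed with. The columns chosen are already
    columns of A_G, and the permanent is -2. *)
Lemma good_triangle v0 v1 v e f g :
  v0 != v1 -> v != v0 -> v != v1 -> src e = v1 -> tgt e = v0 ->
  src f = v -> tgt f = v0 -> src g = v -> tgt g = v1 ->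
  (forall e', src e' = v0 \/ src e' = v1 -> e' = e) ->
  (forall e', src e' = v -> e' = f \/ e' = g) ->
  good [set v0; v1; v].
Proof.
move=> v01 vv0 vv1 se te sf tf sg tg alle allv.
have v10 : v1 != v0 by rewrite eq_sym.
have v0v : v0 != v by rewrite eq_sym.
have v1v : v1 != v by rewrite eq_sym.
apply: (@good_extend _ [set v0; v1; v] [:: f; g; e]
  [:: zcol (inl v); zcol (inl v1); zcol (inr f)]
  [:: [:: -1; -1; 0]; [:: 0; 1; -1]; [:: 0; -1; 1]]%Z) => //.
- by move=> e'; rewrite setDv inE.
- by rewrite setDv; exact: good0.
- rewrite /= !inE negb_or andbT -andbA; apply/and3P; split.
  + by apply: contraNneq v01 => E; rewrite -tf -tg E.
  + by apply: contraNneq v1v => E; rewrite -sf -se E.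
  by apply: contraNneq v1v => E; rewrite -sg -se E.
- move=> e'; rewrite !inE; apply/idP/idP.
    by move=> /or3P[] /eqP ->; rewrite ?sf ?sg ?se eqxx ?orbT.
  case/orP; last by move=> /eqP/allv[] ->; rewrite eqxx ?orbT.
  by move=> /pred2P/alle ->; rewrite eqxx ?orbT.
- rewrite /= zcol_edge_fun sf tf.
  rewrite !(zcol_src R sf) !(zcol_src R sg) !(zcol_src R se).
  rewrite !(zcol_tgt R tf) !(zcol_tgt R tg) !(zcol_tgt R te).
  rewrite !(@zcol0 R G o) ?sf ?sg ?se ?tf ?tg ?te //.
  by congr [:: [:: _; _; _]; [:: _; _; _]; [:: _; _; _]]; ring.
- move=> c e' Hc H0; have Z0 : zcol (inl v0) e' = 0 by rewrite H0 // !inE eqxx.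
  have Z1 : zcol (inl v1) e' = 0 by rewrite H0 // !inE eqxx orbT.
  have Z : zcol (inl v) e' = 0 by rewrite H0 // !inE eqxx orbT.
  case: Hc => [<-|[<-|[<-|[]]]] //.
  by rewrite zcol_edge sf tf Z Z0 addr0.
move=> cs rs nz; exists [:: v; v1], [:: f]; split=> //.
- by rewrite /= inE vv1.
- by move=> x; rewrite !inE => /pred2P[] ->; rewrite eqxx ?orbT.
by move=> x; rewrite !inE => /eqP ->; rewrite eqxx.
Qed.

End Extension.

(** * Dismantling a 2-tree *)

Section TwoTree.
Variables (R : realType) (G : sgraph) (o : orientation G).
Notation src := (src o).
Notation tgt := (tgt o).
Variables (v0 v1 : G).
Hypotheses (o_acyclic : acyclic o) (adj01 : adj v0 v1)
  (outdeg0 : outdeg o v0 = 0) (outdeg1 : outdeg o v1 = 1)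
  (outdeg2 : forall v, v != v0 -> v != v1 -> outdeg o v = 2 /\
       (forall x y, darc o v x -> darc o v y -> x != y -> adj x y)).

Lemma src_neq_v0 e : src e != v0.
Proof.
apply/eqP => E; have /card0_eq/(_ (tgt e)) := outdeg0.
by rewrite inE -E darc_edge.
Qed.

Lemma root_edge : exists e, [/\ src e = v1, tgt e = v0 &
  forall e', src e' = v0 \/ src e' = v1 -> e' = e].
Proof.
have [e [[E _]|[se te]]] := adj_or o adj01.
  by have := src_neq_v0 e; rewrite E eqxx.
exists e; split=> // e' [E|E]; first by have := src_neq_v0 e'; rewrite E eqxx.
have /eqP/cards1P[x Hx] := outdeg1.
have H e1 : src e1 = v1 -> tgt e1 = x.
  by move=> E1; apply/set1P; rewrite -Hx inE -E1 darc_edge.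
by apply: (edge_eq_ends (o := o)); rewrite ?E ?se // !H.
Qed.

Lemma other_edge e : src e != v1 -> exists g,
  [/\ src g = src e, tgt g != tgt e, adj (tgt e) (tgt g) &
    forall e', src e' = src e -> e' = e \/ e' = g].
Proof.
move=> ne1; have [d2 Hadj] := outdeg2 (src_neq_v0 e) ne1.
have [g [sg tg allg]] := outdeg2_other d2.
exists g; split=> //; apply: Hadj; rewrite 1?eq_sym //; first exact: darc_edge.
by rewrite -sg darc_edge.
Qed.

Lemma root_edges v : v != v0 -> v != v1 ->
  (forall e, src e = v -> tgt e = v0 \/ tgt e = v1) ->
  exists f g, [/\ src f = v, src g = v, tgt f = v0, tgt g = v1 &
    forall e, src e = v -> e = f \/ e = g].
Proof.
move=> n0 n1 Hv; have [d2 _] := outdeg2 n0 n1.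
have [e se] : exists e, src e = v by apply: outdeg_gt0; rewrite d2.
have [g [sg tg _ allg]] : exists g, [/\ src g = src e, tgt g != tgt e,
    adj (tgt e) (tgt g) & forall e', src e' = src e -> e' = e \/ e' = g].
  by apply: other_edge; rewrite se.
rewrite se in sg allg.
case: (Hv e se) (Hv g sg) => te [] tg'; rewrite ?te ?tg' ?eqxx // in tg *.
  by exists e, g.
by exists g, e; split=> // e' /allg[]; [right|left].
Qed.

(** * Reducing an out-closed set *)

Section Step.
Variable U : {set G}.
Hypotheses (U0 : v0 \in U) (U1 : v1 \in U) (U_closed : out_closed o U).
Hypothesis IH : forall W : {set G}, W \proper U -> v0 \in W -> v1 \in W ->
  out_closed o W -> good R o W.

(** As no arc enters [X] from the rest of [U], removing [X] preserves out-closedness; [x] shows that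
    the set shrinks. *)
Lemma good_setD (X : {set G}) x : x \in X -> x \in U -> v0 \notin X ->
  v1 \notin X ->
  (forall e, src e \in U -> tgt e \in X -> src e \in X) ->
  out_closed o (U :\: X) /\ good R o (U :\: X).
Proof.
move=> xX xU n0 n1 HX; have Hcl : out_closed o (U :\: X).
  move=> e; rewrite !inE => /andP[neX eU]; rewrite U_closed // andbT.
  by apply: contra neX; exact: HX.
split=> //; apply: IH => //; rewrite ?inE ?n0 ?n1 //.
by apply/properP; split; [exact: subsetDl|exists x; rewrite // inE xX].
Qed.

Definition source_in v := forall e, src e \in U -> tgt e != v.

Lemma twins_step a c : src a \in U -> src c \in U -> src a != src c ->
  src a != v1 -> src c != v1 -> source_in (src a) -> source_in (src c) ->
  tgt a = tgt c ->
  (forall b d, src b = src a -> src d = src c -> tgt b != tgt a ->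
     tgt d != tgt c -> tgt b = tgt d) ->
  good R o U.
Proof.
move=> aU cU nac a1 c1 Sa Sc tac Hbd.
have [b [sb tb _ allb]] := other_edge a1.
have [d [sd td _ alld]] := other_edge c1.
have [|||||Hcl Hg] := @good_setD [set src a; src c] (src a).
- by rewrite !inE eqxx.
- by [].
- by rewrite !inE !(eq_sym v0) !negb_or !src_neq_v0.
- by rewrite !inE !(eq_sym v1) negb_or a1.
- by move=> e eU; rewrite !inE (negPf (Sa e eU)) (negPf (Sc e eU)).
apply: (good_twins aU cU nac Hcl Hg (erefl _) sb (erefl _) sd) => //.
- exact: Hbd.
- by rewrite eq_sym.
- by rewrite !inE negb_or Sa // Sc.
- by rewrite !inE negb_or Sa ?sb // Sc ?sb.
Qed.

(** Every non-root vertex of [U] has exactly the out-neighbours [v0] and [v1], so any two of them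
    are twins; with at most one, [U] is an edge or a triangle. *)
Lemma base_step :
  (forall e, src e \in U -> tgt e = v0 \/ tgt e = v1) -> good R o U.
Proof.
move=> HU; have [e [se te alle]] := root_edge.
have edges_at v : v \in U -> v != v0 -> v != v1 ->
    exists f g, [/\ src f = v, src g = v, tgt f = v0, tgt g = v1 &
      forall e, src e = v -> e = f \/ e = g].
  by move=> vU n0 n1; apply: root_edges => // e' E; apply: HU; rewrite E.
have src_S v : v != v0 -> v != v1 -> source_in v.
  by move=> n0 n1 e' /HU[] ->; rewrite eq_sym.
have v01 : v0 != v1 by rewrite -se -te eq_sym src_tgt.
have [/eqP S0|] := boolP (U :\: [set v0; v1] == set0).
  have -> : U = [set v0; v1].
    apply/eqP; rewrite eqEsubset -setD_eq0 S0 eqxx /=.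
    by apply/subsetP => x; rewrite !inE => /pred2P[] ->.
  exact: good_edge se te alle.
case/set0Pn => v; rewrite !inE negb_or => /andP[/andP[n0 n1] vU].
have [f [g [sf sg tf tg allv]]] := edges_at v vU n0 n1.
have [/eqP S0|] := boolP (U :\: [set v0; v1; v] == set0).
  have -> : U = [set v0; v1; v].
    apply/eqP; rewrite eqEsubset -setD_eq0 S0 eqxx /=.
    by apply/subsetP => x; rewrite !inE => /orP[/pred2P[]|/eqP] ->.
  exact: (good_triangle R v01 n0 n1 se te sf tf sg tg alle allv).
case/set0Pn => w; rewrite !inE !negb_or => /andP[/andP[/andP[m0 m1] wv] wU].
have [f' [g' [sf' sg' tf' tg' allw]]] := edges_at w wU m0 m1.
apply: (@twins_step f f'); rewrite ?sf ?sf' ?tf ?tf' // 1?eq_sym //.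
- exact: src_S.
- exact: src_S.
move=> b d /allv[] -> /allw[] ->; by rewrite ?tf ?tf' ?tg ?tg' ?eqxx.
Qed.

(** The other out-neighbour of a child of [v] is one of the two out-neighbours of [v]. Children
    agreeing on it are twins; otherwise there are at most two children, and [good_child] or
    [good_children] applies. *)
Lemma child_step v a0 : v \in U -> v != v0 -> v != v1 ->
  src a0 \in U -> tgt a0 = v ->
  (forall a, src a \in U -> tgt a = v -> source_in (src a)) -> good R o U.
Proof.
move=> vU n0 n1 a0U ta0 Hsrc.
have [er [ser ter aller]] := root_edge.
have src1 a : tgt a = v -> src a != v1.
  move=> ta; apply: contraNneq n0 => E.
  by rewrite -ta (aller a) ?ter //; right.
have child a : src a \in U -> tgt a = v -> exists b f,
    [/\ src b = src a, tgt b != v,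
        forall e, src e = src a -> e = a \/ e = b, src f = v & tgt f = tgt b].
  move=> aU ta; have [b [sb tb Hadj allb]] := other_edge (src1 a ta).
  rewrite ta in tb Hadj.
  (* The edge between [v] and [tgt b] leaves [v]: otherwise [tgt b] would be an in-neighbour of [v],
     hence a source, although [b] enters it. *)
  have [f [[sf tf]|[sf tf]]] := adj_or o Hadj; first by exists b, f.
  have fU : src f \in U by rewrite sf U_closed // sb.
  by have := Hsrc f fU tf b; rewrite sb sf eqxx => /(_ aU).
have twins a c b d : src a \in U -> src c \in U -> tgt a = v -> tgt c = v ->
    a != c -> src b = src a -> src d = src c ->
    tgt b != v -> tgt d != v -> tgt b = tgt d -> good R o U.
  move=> aU cU ta tc nac sb sd tb td tbd.
  have other x y z : src x = src z -> src y = src z -> tgt z = v ->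
      tgt x != v -> tgt y != v -> tgt x = tgt y.
    move=> sx sy tz tx ty; have [k [_ _ _ allk]] := other_edge (src1 z tz).
    have /eqP xz : x != z by apply: contraNneq tx => ->; rewrite tz.
    have /eqP yz : y != z by apply: contraNneq ty => ->; rewrite tz.
    by case: (allk _ sx) (allk _ sy) => // -> [] // ->.
  apply: (@twins_step a c); rewrite ?src1 ?ta ?tc //.
  - by apply: contraNneq nac => E; apply/eqP/(edge_eq_ends E); rewrite ta tc.
  - exact: Hsrc.
  - exact: Hsrc.
  move=> x y sx sy tx ty.
  by rewrite (other x b a) // (other y d c).
have [b0 [f [sb0 tb0 allb0 sf tf]]] := child _ a0U ta0.
have [g [sg tg _ allv]] : exists g, [/\ src g = src f, tgt g != tgt f,
    adj (tgt f) (tgt g) & forall e', src e' = src f -> e' = f \/ e' = g].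
  by apply: other_edge; rewrite sf.
rewrite sf in sg allv.
have tfg : tgt f != tgt g by rewrite eq_sym.
have tv e : src e = v -> tgt e != v by move=> <-; rewrite eq_sym src_tgt.
have tchild e a : src e \in U -> src a \in U -> tgt a = v -> tgt e != src a.
  by move=> eU aU ta; apply: Hsrc.
have u0v : src a0 != v by rewrite -ta0 src_tgt.
have [/existsP[c /and3P[ca0 cU /eqP tc]]|/existsPn none] :=
    boolP [exists c : edge G, [&& c != a0, src c \in U & tgt c == v]]; last first.
  have [|||||Hcl Hg] := @good_setD [set v; src a0] v; rewrite ?inE ?eqxx //.
  - by rewrite !(eq_sym v0) negb_or n0 src_neq_v0.
  - by rewrite !(eq_sym v1) negb_or n1 src1.
  - move=> e eU; rewrite !inE (negPf (tchild _ _ eU a0U ta0)) orbF => te.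
    have := none e; rewrite eU te /= andbT negbK => /eqP ->.
    by rewrite eqxx orbT.
  apply: (good_child vU a0U u0v Hcl Hg sf sg (erefl _) sb0 allv allb0) => //.
  - by rewrite !inE negb_or tv // tchild // sf.
  - by rewrite !inE negb_or tv // tchild // sg.
have [d [f' [sd td alld sf' tf']]] := child _ cU tc.
(* If [f'] is [f], the children [src a0] and [src c] are twins; from here on [f'] is [g]. *)
case: (allv _ sf') => Ef'.
  by apply: (twins a0 c b0 d) => //; rewrite 1?eq_sym // -tf -tf' Ef'.
rewrite Ef' in tf'.
(* By pigeonhole, a third child is a twin of one of the first two. *)
have [/existsP[c' /and4P[c'a0 c'c c'U /eqP tc']]|/existsPn none] :=
    boolP [exists c' : edge G,
      [&& c' != a0, c' != c, src c' \in U & tgt c' == v]].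
  have [d' [f'' [sd' td' _ sf'' tf'']]] := child _ c'U tc'.
  case: (allv _ sf'') => E; rewrite E in tf''.
    by apply: (twins a0 c' b0 d') => //; rewrite 1?eq_sym // -tf.
  by apply: (twins c c' d d') => //; rewrite 1?eq_sym // -tf'.
have uw : src a0 != src c.
  by apply: contraNneq ca0 => E; apply/eqP/(edge_eq_ends (esym E)); rewrite ta0 tc.
have wv : src c != v by rewrite -tc src_tgt.
have [|||||Hcl Hg] := @good_setD [set v; src a0; src c] v; rewrite ?inE ?eqxx //.
- by rewrite !(eq_sym v0) !negb_or n0 !src_neq_v0.
- by rewrite !(eq_sym v1) !negb_or n1 !src1.
- move=> e eU; rewrite !inE (negPf (tchild _ _ eU a0U ta0)).
  rewrite (negPf (tchild _ _ eU cU tc)) !orbF => te.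
  have := none e; rewrite eU te /= andbT negb_and !negbK.
  by move=> /pred2P[] ->; rewrite eqxx ?orbT.
apply: (good_children vU a0U cU u0v wv uw Hcl Hg sf sg (erefl _) sb0
  (erefl _) sd allv allb0 alld) => //.
- by rewrite !inE !negb_or tv // !tchild // sf.
- by rewrite !inE !negb_or tv // !tchild // sg.
Qed.

End Step.

Lemma good_closed (U : {set G}) :
  v0 \in U -> v1 \in U -> out_closed o U -> good R o U.
Proof.
have [n] := ubnP #|U|; elim: n U => // n IHn U Hn U0 U1 Ucl.
have IH (W : {set G}) : W \proper U -> v0 \in W -> v1 \in W -> out_closed o W -> good R o W.
  by move=> /proper_card HW; apply: IHn; apply: leq_trans HW _.
pose P v := [&& v \in U, v != v0, v != v1 &
  [exists e : edge G, (src e \in U) && (tgt e == v)]].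
have [/existsP[v Pv]|/existsPn none] := boolP [exists v, P v].
  case: (arg_maxnP (height o) Pv) => {Pv} {}v.
  case/and4P=> vU n0 n1 /existsP[a /andP[aU /eqP ta]] vmax.
  apply: (child_step U0 U1 Ucl IH vU n0 n1 aU ta) => {a aU ta} a aU ta e eU.
  have [er [_ ter aller]] := root_edge.
  (* An arc into [src a] would put [src a] in [P], although it is higher than [v]. *)
  apply/negP => te; suff /vmax : P (src a).
    by rewrite /= leqNgt -ta height_lt.
  rewrite /P aU src_neq_v0 /=; apply/andP; split.
    by apply: contraNneq n0 => E; rewrite -ta (aller a) ?ter //; right.
  by apply/existsP; exists e; rewrite eU.
apply: base_step => // e eU; have := none (tgt e).
rewrite /P Ucl //=; case: eqP => [|_]; first by left.
case: eqP => [|_]; first by right.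
by move=> /existsPn/(_ e); rewrite eU eqxx.
Qed.

End TwoTree.

(** * Permanent index and choosability *)

Section Conclusions.
Local Open Scope ring_scope.
Variables (R : realType) (G : sgraph) (o : orientation G).
Notation src := (src o).
Notation tgt := (tgt o).
Notation zcol := (zcol R o).

Lemma per_row_scale m (A B : 'M[R]_m) (k : 'I_m -> R) :
  (forall i j, A i j = k i * B i j) -> per A = (\prod_i k i) * per B.
Proof.
move=> H; rewrite /per big_distrr /=; apply: eq_bigr => s _.
by rewrite -big_split /=; apply: eq_bigr => i _; rewrite H.
Qed.

Lemma entryG_orientation (o' : orientation G) e z :
  entryG R o' e z = (if Defs.src o' e == src e then 1 else -1) * entryG R o e z.
Proof.
rewrite !entryGE zcolE.
have := src_tgt o' e; have := src_edge o' e; have := tgt_edge o' e.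
rewrite (ends o e) !inE => /pred2P[] -> /pred2P[] ->; rewrite ?eqxx // => _.
  by rewrite eq_sym (negPf (src_tgt o e)) mulN1r opprB.
by rewrite mul1r.
Qed.

Lemma map_nth_ord (T S : Type) (f : T -> S) (x0 : T) n (w : seq T) :
  size w = n -> [seq f (nth x0 w j) | j : 'I_n <- enum 'I_n] = map f w.
Proof.
move=> <-; rewrite -[in RHS](mkseq_nth x0 w) /mkseq -val_enum_ord -!map_comp.
exact: eq_map.
Qed.

(** [o] is the orientation used for the construction and [o'] an arbitrary one; passing between them
    multiplies the permanent by a sign. *)
Lemma pind_le1 (o' : orientation G) (e0 : edge G) :
  good R o [set: G] -> pind_le (A_ R o') 1.
Proof.
case=> w [w_uniq _ nz].
have Erows : rows o [set: G] = enum {: edge G}.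
  by rewrite /rows (eq_filter (a2 := predT)) ?filter_predT // => e; rewrite inE.
have Hsz := lper_size nz; rewrite size_map Erows -cardE in Hsz.
(* A default for [nth], never reached. *)
pose z0 : G + edge G := inr e0.
pose c := [ffun i : 'I_#|{: edge G}| => enum_rank (nth z0 w i)].
have c_inj : injective c.
  move=> i j; rewrite !ffunE => /enum_rank_inj.
  by move/eqP; rewrite nth_uniq ?Hsz // => /eqP /val_inj.
apply/existsP; exists c; apply/andP; split; last first.
  apply/forallP => j; apply/card_le1_eqP => i k; rewrite !inE.
  by move=> /eqP <- /eqP/c_inj.
rewrite (@per_row_scale _ _
  (\matrix_(i, j) zcol (nth z0 w j) (enum_val i))
  (fun i => if Defs.src o' (enum_val i) == src (enum_val i) then 1 else -1));
  last first.
  by move=> i j; rewrite !mxE ffunE enum_rankK entryG_orientation entryGE.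
rewrite mulf_neq0 //.
  by apply/prodf_neq0 => i _; case: ifP => _; rewrite ?oppr_eq0 oner_neq0.
rewrite (per_lper (fun j => zcol (nth z0 w j))); last exact: enum_val_inj.
have Hrows : perm_eq (enum {: edge G})
    [seq enum_val i | i <- enum 'I_#|{: edge G}|].
  apply: uniq_perm; rewrite ?(map_inj_uniq enum_val_inj) ?enum_uniq //.
  move=> e; rewrite mem_enum; apply/esym/mapP.
  by exists (enum_rank e); rewrite ?mem_enum ?enum_rankK.
move: nz; rewrite Erows (perm_lper _ Hrows).
by rewrite (map_nth_ord zcol z0 Hsz).
Qed.

(** The edge [e] excludes the value 0: its row must receive some column. Without rows the empty
    permanent is 1 and the index is 0. *)
Lemma pind_eq1 (o' : orientation G) (e : edge G) :
  good R o [set: G] -> pind (A_ R o') = Some 1%N.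
Proof.
move=> /(pind_le1 o' e) H1; rewrite /pind.
case: pselect => [kP|[]]; last by exists 1%N.
case: ex_minnP => -[|[|k]] // Hk; last by move=> /(_ _ H1).
case/existsP: Hk => c /andP[_ /forallP/(_ (c (enum_rank e)))].
rewrite leqNgt => /negP[]; apply/card_gt0P; exists (enum_rank e).
by rewrite inE.
Qed.

(** * Vertex sums and finite differences *)

Lemma vsum_add (f : G + edge G -> R) z k v :
  vsum (fun y => f y + (if y == z then k else 0)) v =
  vsum f v + k * incidence R z v.
Proof.
rewrite /vsum big_split /= addrACA; congr (_ + _).
case: z => [u|g] /=.
  rewrite big1 ?addr0; last by [].
  by rewrite (inj_eq inl_inj); case: (v == u); rewrite ?mulr1 ?mulr0.
rewrite add0r -big_mkcondr /=.
case: (boolP (v \in val g)) => Hv.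
  rewrite (big_pred1 g) ?mulr1 // => e /=.
  rewrite (inj_eq inr_inj); case: (eqVneq e g) => [->|_]; rewrite ?andbF //.
  by rewrite Hv.
rewrite big_pred0 ?mulr0 // => e; rewrite (inj_eq inr_inj).
by case: (eqVneq e g) => [->|_]; rewrite ?andbF // (negPf Hv).
Qed.

Definition vdiff (f : G + edge G -> R) (e : edge G) : R :=
  vsum f (tgt e) - vsum f (src e).

(** The iterated difference is a signed sum of values of the product at the weightings that shift a
    subset of [w] by [d], so one value is nonzero. The clause on labels outside [w] ensures that
    none is shifted twice. *)
Lemma fdiff_weighting (d f : G + edge G -> R) (w : seq (G + edge G)) rs :
  uniq w ->
  fdiff [seq (fun e => d z * zcol z e) | z <- w] rs (vdiff f) != 0 ->
  exists f', [/\ forall z, f' z = f z \/ f' z = f z + d z,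
    forall z, z \notin w -> f' z = f z & \prod_(e <- rs) vdiff f' e != 0].
Proof.
elim: w f => [|z w IH] f /=; first by move=> _ nz; exists f; split; auto.
case/andP=> zw w_uniq.
set D := fdiff _ _ (vdiff f); case: (eqVneq D 0) => [->|nz _]; last first.
  have [f' [H1 H2 H3]] := IH f w_uniq nz; exists f'; split=> // y.
  by rewrite inE negb_or => /andP[_ /H2].
rewrite subr0.
have -> : (fun r => vdiff f r + d z * zcol z r) =
    vdiff (fun y => f y + (if y == z then d z else 0)).
  by apply: funext => e; rewrite /vdiff !vsum_add zcolE; ring.
move=> /(IH _ w_uniq) [f' [H1 H2 H3]]; exists f'; split=> // y.
  case: (eqVneq y z) => [->|ne]; first by right; rewrite H2 // eqxx.
  by have := H1 y; rewrite (negPf ne) addr0.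
by rewrite inE negb_or => /andP[ne /H2 ->]; rewrite (negPf ne) addr0.
Qed.

Lemma good_choosable : good R o [set: G] -> choosable R 2 2 G.
Proof.
case=> w [w_uniq _ nz] L HLv HLe.
have HL z : size (L z) = 2%N by case: z => [v|e]; [exact: HLv|exact: HLe].
(* The two elements of [L z] are [f0 z] and [f0 z + d z]. *)
pose f0 z := nth 0 (L z) 0; pose d z := nth 0 (L z) 1 - f0 z.
have d_nz z : d z != 0.
  by rewrite subr_eq0 /f0 nth_uniq ?HL // fset_uniq.
have : fdiff [seq (fun e => d z * zcol z e) | z <- w] (rows o [set: G]) (vdiff f0)
    != 0.
  (* There are as many directions as rows, so the difference is the permanent times the product of
     all [d z]. *)
  rewrite fdiff_lper ?rows_uniq //; last first.
    by rewrite -(lper_size nz) !size_map.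
  rewrite lper_scale mulf_neq0 // prodf_seq_neq0.
  by apply/allP => z _; rewrite d_nz.
case/(fdiff_weighting w_uniq) => f [Hf _ Hprod]; exists f; last first.
  move=> z; case: (Hf z) => ->; rewrite /d ?(addrC (f0 z)) ?subrK mem_nth //.
    by rewrite HL.
  by rewrite HL.
have Hne e : vsum f (tgt e) != vsum f (src e).
  rewrite -subr_eq0; move: Hprod; rewrite prodf_seq_neq0 => /allP/(_ e).
  by rewrite mem_rows inE => /(_ isT).
move=> u v /(adj_or o)[e [[<- <-]|[<- <-]]] //.
by rewrite eq_sym.
Qed.

End Conclusions.

Theorem corollary3 (R : realType) (G : sgraph) (hG : two_tree G) :
  (forall o : orientation G, pind (A_ R o) = Some 1) /\ choosable R 2 2 G.
Proof.
have [o o_acyclic [v0 [v1 [adj01 d0 d1 d2]]]] := hG.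
have Hgood : good R o [set: G].
  by apply: (good_closed R o_acyclic adj01 d0 d1 d2) => // e; rewrite !inE.
have [e _] := adj_or o adj01.
by split=> [o'|]; [exact: pind_eq1 e Hgood|exact: good_choosable Hgood].
Qed.
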